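(* Let $X$ be a separable infinite dimensional Banach space which is elastic. Then $X$ contains a subspace isomorphic to $c_0$.
   Context: A Banach space $Y$ $K$-embeds into $X$ if there is a linear map $T:Y\to X$ with $\|y\|\le\|Ty\|\le K\|y\|$ for all $y\in Y$. $X$ is $K$-elastic if every Banach space $Y$ isomorphic to a subspace of $X$ $K$-embeds into $X$; $X$ is elastic if it is $K$-elastic for some $K<\infty$. *)

(* Defs.v *)
From HB Require Import structures.
From mathcomp Require Import all_boot all_order all_algebra.
From mathcomp Require Import all_classical all_reals all_analysis.
Set Implicit Arguments. Unset Strict Implicit. Unset Printing Implicit Defensive.
Import Order.TTheory GRing.Theory Num.Theory.
Import numFieldNormedType.Exports.
Local Open Scope classical_set_scope.
Local Open Scope ring_scope.

Definition is_linear (R : realType) (U V : lmodType R) (T : U -> V) : Prop :=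
  forall (a : R) (x y : U), T (a *: x + y) = a *: T x + T y.

Definition K_embeds (R : realType) (K : R) (Y X : normedModType R) : Prop :=
  exists T : Y -> X, is_linear T /\
    forall y : Y, `|y| <= `|T y| /\ `|T y| <= K * `|y|.

Definition iso_to_subspace (R : realType) (Y X : normedModType R) : Prop :=
  exists T : Y -> X, is_linear T /\ exists c C : R, 0 < c /\
    forall y : Y, c * `|y| <= `|T y| /\ `|T y| <= C * `|y|.

Definition K_elastic (R : realType) (K : R) (X : completeNormedModType R) : Prop :=
  forall Y : completeNormedModType R, iso_to_subspace Y X -> K_embeds K Y X.

Definition elastic (R : realType) (X : completeNormedModType R) : Prop :=
  exists K : R, K_elastic K X.

Definition separable (R : realType) (X : normedModType R) : Prop :=
  exists D : set X, countable D /\ dense D.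

Definition infinite_dimensional (R : realType) (X : normedModType R) : Prop :=
  forall s : seq X, exists x : X,
    forall c : 'I_(size s) -> R, x <> \sum_(i < size s) c i *: nth 0 s i.

Definition c0 (R : realType) : set (nat -> R) := [set u | u @ \oo --> 0].

Definition c0_norm (R : realType) (u : nat -> R) : R :=
  sup [set `|u n| | n in [set: nat]].

Definition contains_c0 (R : realType) (X : normedModType R) : Prop :=
  exists T : (nat -> R) -> X,
    (forall (a : R) (u v : nat -> R), c0 u -> c0 v ->
        T (fun n => a * u n + v n) = a *: T u + T v) /\
    exists c C : R, 0 < c /\
      forall u, c0 u -> c * c0_norm u <= `|T u| /\ `|T u| <= C * c0_norm u.

(* Main.v *)
Require Import Defs.
From HB Require Import structures.
From mathcomp Require Import all_boot all_order all_algebra.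
From mathcomp Require Import all_classical all_reals all_analysis.
From mathcomp Require Import ring lra.

(* Let d be a dense sequence of X and let X be K-elastic. The finite index
   sequences u for which d_(u_0), ..., d_(u_(l-1)) is equivalent to the basis of
   l_infty^l, with constants depending only on K, form a tree, and an infinite
   branch of it spans c_0. If the tree is well founded, induction on it yields a
   countable family of vectors, indexed by the nodes, with uniformly bounded
   coordinate functionals and a c_0 upper estimate with constant K along every
   branch: families obtained for the subtrees are put together, at the cost of
   a worse constant, by passing to differences that are nearly orthogonal to
   the previously chosen vectors, and K is restored by embedding a renorming of
   X into X. The chain of vectors above a node u is one longer than u, so
   approximating these vectors by d turns each node into a longer one, and
   iterating from the empty sequence produces an infinite branch after all. *)

Set Implicit Arguments. Unset Strict Implicit. Unset Printing Implicit Defensive.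
Import Order.TTheory GRing.Theory Num.Theory.
Import numFieldNormedType.Exports.
Local Open Scope classical_set_scope.
Local Open Scope ring_scope.

(** * Equivalent norms, and elasticity under renorming *)

Record equiv_norm (R : realType) (X : normedModType R) := EquivNorm {
  enorm :> X -> R;
  enormD : forall x y, enorm (x + y) <= enorm x + enorm y;
  enormZ : forall (l : R) x, enorm (l *: x) = `|l| * enorm x;
  enorm_lo : R;
  enorm_hi : R;
  enorm_lo_gt0 : 0 < enorm_lo;
  enorm_ge : forall x, enorm_lo * `|x| <= enorm x;
  enorm_le : forall x, enorm x <= enorm_hi * `|x| }.

(** A fresh name for [X], so that the norm [N] can be registered without clashing with the norm that
    [X] already carries. *)
Definition renormed (R : realType) (X : normedModType R) (N : equiv_norm X) : Type := X.

Section Renormed.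
Variables (R : realType) (X : completeNormedModType R) (N : equiv_norm X).

HB.instance Definition _ := GRing.Lmodule.copy (renormed N) X.

Lemma enorm_eq0 (x : renormed N) : N x = 0 -> x = 0.
Proof.
move=> Nx0; have := enorm_ge N x; rewrite Nx0 pmulr_rle0 ?enorm_lo_gt0//.
by rewrite normr_le0 => /eqP.
Qed.

HB.instance Definition _ := @Lmodule_isNormed.Build R (renormed N) N
  (@enormD _ _ N) (@enormZ _ _ N) enorm_eq0.

Lemma renormed_complete (F : set_system (renormed N)) :
  ProperFilter F -> cauchy F -> cvg F.
Proof.
move=> FF /cauchy_ballP Fc; have lo0 := enorm_lo_gt0 N.
have Xc : cauchy (F : set_system X).
  apply/cauchy_ballP => e e0.
  have /Fc : 0 < enorm_lo N * e by rewrite mulr_gt0.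
  apply: filterS => -[x y] /=; rewrite -!ball_normE /= => xy.
  rewrite -(ltr_pM2l lo0); apply: le_lt_trans xy.
  exact: (@enorm_ge _ _ N (x - y : X)).
have /(@cvg_ex X)[l Fl] := @cauchy_cvg X F FF Xc.
apply/(@cvg_ex (renormed N)); exists l.
apply/(@cvgrPdist_lt _ (renormed N)) => e e0.
pose h := `|enorm_hi N| + 1; have h0 : 0 < h by rewrite ltr_wpDl.
move/cvgrPdist_lt : Fl => /(_ (e / h)); rewrite divr_gt0// => /(_ isT).
apply: filterS => t; rewrite ltr_pdivlMr// mulrC; apply: le_lt_trans.
apply: (le_trans (enorm_le N (l - t : X))); rewrite ler_wpM2r//.
by rewrite /h (le_trans (ler_norm _))// lerDl.
Qed.

HB.instance Definition _ := Uniform_isComplete.Build (renormed N) renormed_complete.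

End Renormed.

(** The identity is an isomorphism of the renormed space onto [X], so elasticity applies. The point
    is that [K] does not depend on [N], however large its distortion. *)
Lemma elastic_renormed (R : realType) (X : completeNormedModType R) (K : R)
    (N : equiv_norm X) : K_elastic K X ->
  exists T : X -> X, is_linear T /\ forall x, N x <= `|T x| <= K * N x.
Proof.
move=> /(_ (renormed N : completeNormedModType R))[].
  exists (fun x : X => x); split => //.
  have := enorm_lo_gt0 N; have := enorm_le N; have := enorm_ge N.
  set c := enorm_lo N; set h := enorm_hi N => gec leh c0.
  pose h1 := `|h| + 1; have h0 : 0 < h1 by rewrite ltr_wpDl.
  exists h1^-1, c^-1; split; first by rewrite invr_gt0.
  move=> y; rewrite ler_pdivrMl// ler_pdivlMl//; split; last exact: gec.
  apply: (le_trans (leh (y : X))); rewrite ler_wpM2r//.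
  by rewrite /h1 (le_trans (ler_norm _))// lerDl.
by move=> T [Tl TK]; exists T; split => // x; have [-> ->] := TK x.
Qed.

(** * Sequences with uniformly bounded coordinate functionals; infimal convolution *)

Definition coord_bounded (R : realType) (X : normedModType R) (C : R)
    (z : nat -> X) :=
  forall (n : nat) (a : nat -> R) (i : nat), (i < n)%N ->
    `|a i| <= C * `|\sum_(j < n) a j *: z j|.

Lemma sum_widen (R : realType) (X : normedModType R) (z : nat -> X)
    (a : nat -> R) n N : (n <= N)%N ->
  \sum_(i < n) a i *: z i = \sum_(i < N) (if (i < n)%N then a i else 0) *: z i.
Proof.
move=> nN; rewrite (big_ord_widen N (fun i => a i *: z i))// big_mkcond.
by apply: eq_bigr => i _; case: ifP => //; rewrite scale0r.
Qed.

Section InfConvolution.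
Variables (R : realType) (X : normedModType R) (C : R) (z : nat -> X).
Hypotheses (C_gt0 : 0 < C) (z_coord : coord_bounded C z).

Let S (x : X) : set R := [set s | exists n (a : nat -> R) r,
  (forall i, `|a i| <= r) /\ s = r + C * `|x - \sum_(i < n) a i *: z i| ].

(* For x in the span of z, [c0_conv x] is the sup norm of the coordinates of x;
   it extends that seminorm to X without the Hahn-Banach theorem. *)
Definition c0_conv (x : X) : R := inf (S x).

Let S_ge0 x s : S x s -> 0 <= s.
Proof.
move=> [n [a [r [ar ->]]]]; apply: addr_ge0; first exact: le_trans (ar 0%N).
by rewrite mulr_ge0// ltW.
Qed.

Let c0_conv_le x s : S x s -> c0_conv x <= s.
Proof. by move=> Sxs; apply: ge_inf => //; exists 0 => ? /S_ge0. Qed.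

Let S_neq0 x : S x (C * `|x|).
Proof.
by exists 0%N, (fun=> 0), 0; rewrite big_ord0 subr0 add0r normr0.
Qed.

Let le_c0_conv x b : (forall s, S x s -> b <= s) -> b <= c0_conv x.
Proof. by move=> Sb; apply: lb_le_inf => //; exists (C * `|x|). Qed.

Lemma c0_conv_ge0 x : 0 <= c0_conv x.
Proof. by apply: le_c0_conv => s /S_ge0. Qed.

Lemma c0_conv_le_norm x : c0_conv x <= C * `|x|.
Proof. exact/c0_conv_le/S_neq0. Qed.

Let c0_convZ_le l x : l != 0 -> c0_conv (l *: x) <= `|l| * c0_conv x.
Proof.
move=> l0; rewrite -ler_pdivrMl ?normr_gt0//; apply: le_c0_conv => s.
move=> [n [a [r [ar ->]]]]; rewrite ler_pdivrMl ?normr_gt0//.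
apply: c0_conv_le; exists n, (fun i => l * a i), (`|l| * r); split.
  by move=> i; rewrite normrM ler_wpM2l.
rewrite mulrDr mulrCA -normrZ scalerBr scaler_sumr.
by under [in RHS]eq_bigr do rewrite -scalerA.
Qed.

Lemma c0_convZ l x : c0_conv (l *: x) = `|l| * c0_conv x.
Proof.
have [->|l0] := eqVneq l 0.
  rewrite scale0r normr0 mul0r; apply/eqP.
  rewrite eq_le c0_conv_ge0 andbT.
  by rewrite (le_trans (c0_conv_le_norm _))// normr0 mulr0.
apply/eqP; rewrite eq_le c0_convZ_le//= -ler_pdivlMl ?normr_gt0//.
rewrite -normfV -[x in leLHS](scalerK l0); apply: c0_convZ_le.
by rewrite invr_eq0.
Qed.

Lemma c0_convD x y : c0_conv (x + y) <= c0_conv x + c0_conv y.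
Proof.
rewrite -lerBlDr; apply: le_c0_conv => s [n [a [r [ar ->]]]].
rewrite lerBlDl -lerBlDr; apply: le_c0_conv => t [m [b [q [bq ->]]]].
rewrite lerBlDr.
pose a' i := if (i < n)%N then a i else 0.
pose b' i := if (i < m)%N then b i else 0.
have a'r i : `|a' i| <= r.
  by rewrite /a'; case: ifP => // _; rewrite normr0 (le_trans _ (ar 0%N)).
have b'q i : `|b' i| <= q.
  by rewrite /b'; case: ifP => // _; rewrite normr0 (le_trans _ (bq 0%N)).
have -> := sum_widen z a (leq_addr m n).
have -> := sum_widen z b (leq_addl n m).
apply: (@le_trans _ _ ((r + q) + C * `|(x + y) -
    \sum_(i < n + m) (a' i + b' i) *: z i|)).
  apply: c0_conv_le; exists (n + m)%N, (fun i => a' i + b' i), (r + q).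
  by split => // i; rewrite (le_trans (ler_normD _ _))// lerD.
under eq_bigr do rewrite scalerDl.
rewrite big_split/= [leRHS]addrACA (addrC q r) lerD2l -mulrDr addrC.
by rewrite ler_wpM2l ?(ltW C_gt0)// (addrC x y) opprD addrACA ler_normD.
Qed.

Lemma c0_conv_sum_le n (a : nat -> R) r : (forall i, `|a i| <= r) ->
  c0_conv (\sum_(i < n) a i *: z i) <= r.
Proof.
move=> ar; apply: c0_conv_le; exists n, a, r; split => //.
by rewrite subrr normr0 mulr0 addr0.
Qed.

(** Against a competitor with coefficients [b] bounded by [r], [z_coord] for the difference of the
    two combinations bounds [a i - b i] by the error term. Zeros pad both to a common length. *)
Lemma c0_conv_sum_ge n (a : nat -> R) i : (i < n)%N ->
  `|a i| <= c0_conv (\sum_(i < n) a i *: z i).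
Proof.
move=> ilen; apply: le_c0_conv => s [m [b [r [br ->]]]].
pose a' i := if (i < n)%N then a i else 0.
pose b' i := if (i < m)%N then b i else 0.
have -> := sum_widen z a (leq_addr m n).
have -> := sum_widen z b (leq_addl n m).
rewrite -sumrB; under eq_bigr do rewrite -scalerBl.
have inm : (i < n + m)%N by rewrite (leq_trans ilen)// leq_addr.
have := z_coord (fun j => a' j - b' j) inm.
have -> : a i = (a' i - b' i) + b' i by rewrite subrK /a' ilen.
move=> h; rewrite (le_trans (ler_normD _ _))// addrC lerD//.
by rewrite /b'; case: ifP => // _; rewrite normr0 (le_trans _ (br 0%N)).
Qed.

End InfConvolution.

(** * Restoring the constants by elasticity *)

Section ElasticImprove.
Variables (R : realType) (X : completeNormedModType R) (K : R).
Hypotheses (K_ge0 : 0 <= K) (elX : K_elastic K X).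

Lemma elastic_improve (C M : R) (z : nat -> X) : 0 < C -> 0 < M ->
    coord_bounded C z ->
  exists x : nat -> X, coord_bounded 1 x /\
    forall n (a : nat -> R) r, (forall i, `|a i| <= r) ->
      `|\sum_(i < n) a i *: z i| <= M * r ->
      `|\sum_(i < n) a i *: x i| <= K * r.
Proof.
move=> C0 M0 zC; have Mi0 : 0 < M^-1 by rewrite invr_gt0.
(* The first term dominates the coordinates; the second makes [N] equivalent to the norm and is at
   most [r] once [|x| <= M * r]. *)
pose N x := Num.max (c0_conv C z x) (M^-1 * `|x|).
have ND x y : N (x + y) <= N x + N y.
  rewrite {1}/N ge_max; apply/andP; split.
    apply: (le_trans (c0_convD z C0 x y)).
    by rewrite /N lerD// le_max lexx.
  rewrite (@le_trans _ _ (M^-1 * `|x| + M^-1 * `|y|))//.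
    by rewrite -mulrDr ler_wpM2l ?(ltW Mi0)// ler_normD.
  by rewrite /N lerD// le_max lexx orbT.
have NZ l x : N (l *: x) = `|l| * N x.
  by rewrite /N c0_convZ// normrZ mulrCA maxr_pMr.
have Nge x : M^-1 * `|x| <= N x by rewrite /N le_max lexx orbT.
have Nle x : N x <= (C + M^-1) * `|x|.
  rewrite /N ge_max mulrDl; apply/andP; split.
    by apply: (le_trans (c0_conv_le_norm z C0 x)); rewrite lerDl mulr_ge0 ?(ltW Mi0).
  by rewrite lerDr mulr_ge0 ?(ltW C0).
have [T [Tlin TK]] := elastic_renormed (EquivNorm ND NZ Mi0 Nge Nle) elX.
have T0 : T 0 = 0.
  have := Tlin 1 0 0; rewrite scaler0 addr0 scale1r => h.
  by apply: (addrI (T 0)); rewrite -h addr0.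
have Tsum n a : T (\sum_(i < n) a i *: z i) = \sum_(i < n) a i *: T (z i).
  apply: (big_ind2 (fun u v => T u = v)) => [//|x u y v <- <-|i _].
    by have := Tlin 1 x y; rewrite !scale1r.
  by have := Tlin (a i) (z i) 0; rewrite T0 !addr0.
exists (T \o z); split => [n a i ilen|n a r ar zr] /=; rewrite -Tsum.
  rewrite mul1r; have /andP[+ _] := TK (\sum_(i < n) a i *: z i).
  apply: le_trans; rewrite /= /N le_max; apply/orP; left.
  exact: c0_conv_sum_ge.
have /andP[_ h] := TK (\sum_(i < n) a i *: z i).
apply: (le_trans h); rewrite ler_wpM2l// /= /N ge_max c0_conv_sum_le//=.
by rewrite ler_pdivrMl.
Qed.

End ElasticImprove.

(** * Nearly orthogonal differences, in the spirit of Mazur's basic sequences *)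

Section NearlyOrthogonal.
Variables (R : realType) (X : normedModType R).

(* The color of l is the largest n with [|n w + x k - x l| <= n (|w| - d)] for
   some k; a pair k, l violating the conclusion has rank l > rank k. It plays the
   role of the values at x l of a functional norming w. *)
Lemma rank_coloring (w : X) (x : nat -> X) (B d : R) : 0 < d ->
    (forall k, `|x k| <= B) ->
  exists (F : finType) (rho : nat -> F), forall k l, rho k = rho l ->
    `|w| - d <= `|w + (x k - x l)|.
Proof.
move=> d0 xB.
pose good l n := `[< exists k, `|w *+ n + (x k - x l)| <= (`|w| - d) *+ n >].
(* For a good [n], the triangle inequality gives [n |w| <= n (|w| - d) + 2 B], hence [n d <= 2 B]:
   the ranks are bounded and finitely many colors suffice. *)
pose N := Num.bound (2 * B / d).
have goodN l n : good l n -> (n <= N)%N.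
  move=> /asboolP[k kn].
  have B0 : 0 <= B by rewrite (le_trans _ (xB 0%N)).
  have : d *+ n <= 2 * B.
    have h1 : `|w *+ n| <= `|w *+ n + (x k - x l)| + `|x k - x l|.
      by rewrite -{1}[w *+ n](addrK (x k - x l)) ler_normB.
    have h2 := ler_normB (x k) (x l).
    have := xB k; have := xB l; move: kn h1 h2.
    rewrite normrMn mulrnBl.
    move: (`|w| *+ n) (d *+ n) `|_ + _| `|x k - x l| `|x k| `|x l|.
    by move=> *; lra.
  rewrite -(mulr_natl d) -ler_pdivlMr// => nB; rewrite -(ler_nat R) ltW//.
  by rewrite (le_lt_trans nB)// archi_boundP// divr_ge0 ?mulr_ge0// ltW.
have good0 l : good l 0%N.
  by apply/asboolP; exists l; rewrite !mulr0n add0r subrr normr0.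
have /choice[rk rkP] l : exists m, good l m /\ forall n, good l n -> (n <= m)%N.
  have [m gm mmax] := ex_maxnP (ex_intro _ 0%N (good0 l)) (@goodN l).
  by exists m.
exists 'I_N.+1, (fun l => inord (rk l)) => k l /(congr1 val).
rewrite /= !inordK ?ltnS; last 2 first.
- by apply: (goodN l); have [] := rkP l.
- by apply: (goodN k); have [] := rkP k.
move=> rkl; rewrite leNgt; apply/negP => bad.
have [/asboolP[k0 hk0] _] := rkP k.
have [_ /(_ (rk k).+1)] := rkP l.
rewrite -rkl ltnn => h; suff: false by []; apply: h.
(* Adding the short vector [w + (x k - x l)] to the one that witnesses the rank of [k] gives [l] a
   rank larger by one, although the two ranks agree. *)
apply/asboolP; exists k0.
have -> : w *+ (rk k).+1 + (x k0 - x l) =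
    (w *+ rk k + (x k0 - x k)) + (w + (x k - x l)).
  by rewrite mulrSr [RHS]addrACA (addrA (_ - _)) subrK.
by rewrite (le_trans (ler_normD _ _))// mulrSr lerD// ltW.
Qed.

Lemma rank_coloring_seq (L : seq X) (x : nat -> X) (B d : R) : 0 < d ->
    (forall k, `|x k| <= B) ->
  exists (F : finType) (rho : nat -> F), forall k l, rho k = rho l ->
    forall w, w \in L -> `|w| - d <= `|w + (x k - x l)|.
Proof.
move=> d0 xB; elim: L => [|w L [F [rho rhoP]]]; first by exists unit, (fun=> tt).
have [F' [rho' rho'P]] := rank_coloring w d0 xB.
exists (F' * F)%type, (fun k => (rho' k, rho k)) => k l [r' r] v.
by rewrite inE => /predU1P[->|/(rhoP _ _ r)//]; exact: rho'P.
Qed.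

Lemma nat_pigeonhole (F : finType) (rho : nat -> F) :
  exists k l, k <> l /\ rho k = rho l.
Proof.
apply: contrapT => h.
have : injective (fun i : 'I_(#|F|.+1) => rho i).
  move=> i j rij; apply/val_inj; apply: contrapT => ij.
  by apply: h; exists i, j.
by move=> /leq_card; rewrite card_ord ltnn.
Qed.

Lemma interval_net (A e : R) : 0 < e ->
  exists G : seq R, forall t, `|t| <= A -> exists2 g, g \in G & `|t - g| <= e.
Proof.
move=> e0; pose N := (Num.bound (2 * A / e)).+1.
exists [seq - A + i%:R * e | i <- iota 0 N] => t tA.
have A0 : 0 <= A by rewrite (le_trans _ tA).
have tA0 : 0 <= (t + A) / e.
  by rewrite divr_ge0 ?(ltW e0)//; move: tA; rewrite ler_norml; lra.
have /andP[nle nlt] := truncn_itv tA0.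
exists (- A + (Num.truncn ((t + A) / e))%:R * e).
  apply/mapP; exists (Num.truncn ((t + A) / e)) => //.
  rewrite mem_iota add0n leq0n /= ltnS -(ler_nat R) (le_trans nle)// ltW//.
  have /archi_boundP : 0 <= 2 * A / e by rewrite divr_ge0 ?mulr_ge0// ltW.
  apply: le_lt_trans; rewrite ler_wpM2r ?invr_ge0 ?(ltW e0)//.
  by move: tA; rewrite ler_norml; lra.
rewrite ler_pdivlMr// in nle; rewrite ltr_pdivrMr// -natr1 mulrDl in nlt.
by rewrite ler_norml; apply/andP; split; lra.
Qed.

Lemma span_net (z : nat -> X) (A d : R) (m : nat) : 0 < d ->
  exists L : seq X, forall a : nat -> R, (forall i, (i < m)%N -> `|a i| <= A) ->
    exists2 w, w \in L & `|\sum_(j < m) a j *: z j - w| <= d.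
Proof.
elim: m d => [|m IH] d d0.
  exists [:: 0] => a _; exists 0; rewrite ?inE//.
  by rewrite big_ord0 subr0 normr0 ltW.
have d2 : 0 < d / 2 by rewrite divr_gt0.
have [L LP] := IH _ d2.
have z1 : 0 < `|z m| + 1 by rewrite ltr_wpDl.
have [G GP] := interval_net A (divr_gt0 d2 z1).
exists [seq w + t *: z m | w <- L, t <- G] => a aA.
have [w wL wd] := LP a (fun i im => aA i (ltnW im)).
have [t tG td] := GP _ (aA m (ltnSn m)).
exists (w + t *: z m); first by apply: allpairs_f.
rewrite big_ord_recr/= opprD addrACA -scalerBl (le_trans (ler_normD _ _))//.
rewrite [leRHS](splitr d) lerD// normrZ.
rewrite ler_pdivlMr// in td; apply: le_trans td.
by rewrite ler_wpM2l// lerDl.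
Qed.

(** By pigeonhole some [k] and [l] share their color for every point of a finite net of a ball in
    the span of [z]. Near the origin and outside the ball, [1 <= |x k - x l| <= 2 * B] is enough;
    scaling reduces nonzero [t] to [t = 1]. *)
Lemma nearly_orthogonal (m : nat) (z x : nat -> X) (C B theta : R) :
    (forall (a : nat -> R) i, (i < m)%N ->
      `|a i| <= C * `|\sum_(j < m) a j *: z j|) ->
    (forall k, `|x k| <= B) -> (forall k l, k <> l -> 1 <= `|x k - x l|) ->
    theta < 1 ->
  exists k l, k <> l /\ forall (a : nat -> R) (t : R),
    theta * `|\sum_(j < m) a j *: z j| <=
    `|\sum_(j < m) a j *: z j + t *: (x k - x l)|.
Proof.
move=> zC xB xsep th1.
(* Beyond [rad], [|e| - 2 * B] is at least [theta * |e|]. Between 1/2 and [rad], two approximations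
   by the net and one use of the coloring lose [3 * d = (1 - theta) / 2], at most
   [(1 - theta) * |e|]. *)
pose rad := 2 * B / (1 - theta); pose d := (1 - theta) / 6.
have th0 : 0 < 1 - theta by rewrite subr_gt0.
have d0 : 0 < d by rewrite divr_gt0.
have B0 : 0 <= B by rewrite (le_trans _ (xB 0%N)).
have rad0 : 0 <= rad by rewrite divr_ge0 ?mulr_ge0// ltW.
have [L LP] := span_net z (`|C| * rad) m d0.
have [F [rho rhoP]] := rank_coloring_seq L d0 xB.
have [k [l [kl rkl]]] := nat_pigeonhole rho.
exists k, l; split => // a t.
set v := x k - x l.
have v1 : 1 <= `|v| by exact: xsep.
have vB : `|v| <= 2 * B.
  by rewrite (le_trans (ler_normB _ _))// mulr_natl mulr2n lerD.
have key (b : nat -> R) : theta * `|\sum_(j < m) b j *: z j| <=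
    `|\sum_(j < m) b j *: z j + v|.
  set e := \sum_(j < m) b j *: z j.
  have ev1 : `|e| - `|v| <= `|e + v|.
    by rewrite lerBlDr -{1}[e](addrK v) ler_normB.
  have ev2 : `|v| - `|e| <= `|e + v|.
    by rewrite lerBlDr -{1}[v](addrK e) (addrC v) ler_normB.
  have [e2|e2] := lerP `|e| (1 / 2).
    have : theta * `|e| <= 1 * `|e| by rewrite ler_wpM2r// ltW.
    lra.
  have [erad|erad] := lerP `|e| rad; last first.
    move: erad; rewrite /rad ltr_pdivrMr// mulrBr mulr1 (mulrC _ theta); lra.
  have [|w wL ew] := LP b.
    move=> i im; apply: (le_trans (zC b i im)).
    apply: (@le_trans _ _ (`|C| * `|e|)); first by rewrite ler_wpM2r// ler_norm.
    by rewrite ler_wpM2l.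
  have := rhoP _ _ rkl w wL; rewrite -/v => wv.
  have h1 : `|w + v| <= `|e + v| + `|e - w|.
    have -> : w + v = (e + v) - (e - w).
      by rewrite opprB [RHS]addrC (addrA (w - e)) subrK.
    exact: ler_normB.
  have h2 : `|e| <= `|e - w| + `|w| by rewrite -{1}[e](subrK w) ler_normD.
  have : (1 - theta) * (1 / 2) <= (1 - theta) * `|e|.
    by rewrite ler_wpM2l// ltW.
  move: ew wv; rewrite -/e /d; lra.
have [->|t0] := eqVneq t 0.
  rewrite scale0r addr0 -[leRHS]mul1r ler_wpM2r// ltW//.
have := key (fun j => t^-1 * a j).
under eq_bigr do rewrite -scalerA; rewrite -scaler_sumr.
set e := \sum_(j < m) a j *: z j.
rewrite -(@ler_pM2l _ `|t|) ?normr_gt0// normrZ mulrCA (mulrA `|t|) -normrM.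
rewrite mulfV// normr1 mul1r => h; apply: (le_trans h).
by rewrite -normrZ scalerDr scalerA mulfV// scale1r.
Qed.

(** The difference from row [i] is chosen nearly orthogonal to the earlier ones. Partial sums are
    then at most twice the full sum, each term is a difference of two partial sums, and [z i] has
    norm at least 1; hence the constant 4. *)
Lemma select_differences (P : nat -> nat -> X) (B : nat -> R) :
    (forall i k, `|P i k| <= B i) ->
    (forall i k l, k <> l -> 1 <= `|P i k - P i l|) ->
  exists p q : nat -> nat, coord_bounded 4 (fun i => P i (p i) - P i (q i)).
Proof.
move=> PB Psep.
(* The finite product of the ratios al m.+1 / al m stays above 1/2. *)
pose al (m : nat) : R := 1 + m.+1%:R^-1.
have al1 m : 1 <= al m by rewrite lerDl invr_ge0.
have al2 m : al m <= 2.
  by rewrite /al -[leRHS]/(1 + 1) lerD2l invf_le1 ?ler1n.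
have al0 m : 0 < al m by rewrite (lt_le_trans ltr01).
have alS m : al m.+1 / al m < 1.
  rewrite ltr_pdivrMr// mul1r ltrD2l ltf_pV2 ?posrE// ltr_nat//.
pose hyp m (z : nat -> X) := forall (a : nat -> R) i, (i < m)%N ->
  `|a i| <= 4 * `|\sum_(j < m) a j *: z j|.
(* The coordinate bound for the vectors already chosen is known only as the recursion proceeds.
   Selecting for arbitrary lists, with the default pair [(0, 1)], separates the construction from
   its correctness. *)
have /choice[sel selP] (t : nat * seq X) : exists kl : nat * nat,
    kl.1 <> kl.2 /\ (hyp t.1 (nth 0 t.2) -> forall (a : nat -> R) (c : R),
    al t.1.+1 / al t.1 * `|\sum_(j < t.1) a j *: nth 0 t.2 j| <=
    `|\sum_(j < t.1) a j *: nth 0 t.2 j + c *: (P t.1 kl.1 - P t.1 kl.2)|).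
  have [h|h] := pselect (hyp t.1 (nth 0 t.2)); last by exists (0, 1)%N.
  have [k [l [kl H]]] := nearly_orthogonal h (PB t.1) (Psep t.1) (alS t.1).
  by exists (k, l).
pose zs := fix zs m := if m is m'.+1 then
  rcons (zs m') (P m' (sel (m', zs m')).1 - P m' (sel (m', zs m')).2) else [::].
pose p m := (sel (m, zs m)).1; pose q m := (sel (m, zs m)).2.
exists p, q; set z := fun i => _.
have zsE m : zs m = mkseq z m by elim: m => //= m IH; rewrite mkseqS -IH.
have z1 i : 1 <= `|z i| by apply: Psep; have [] := selP (i, zs i).
have zsum m (a : nat -> R) :
    \sum_(j < m) a j *: nth 0 (zs m) j = \sum_(j < m) a j *: z j.
  by apply: eq_bigr => j _; rewrite zsE nth_mkseq.
have step m : hyp m z -> forall a : nat -> R,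
    al m.+1 * `|\sum_(j < m) a j *: z j| <= al m * `|\sum_(j < m.+1) a j *: z j|.
  move=> hm a; have [_ /=] := selP (m, zs m).
  have hm' : hyp m (nth 0 (zs m)) by move=> b i im; rewrite zsum; exact: hm.
  move=> /(_ hm' a (a m)); rewrite zsum big_ord_recr/= -/(z m).
  by rewrite mulrAC ler_pdivrMr// (mulrC _ (al m)).
(* The one-step inequalities telescope to the ratio [al n / al m], which is at most 2. *)
pose inv m := forall n (a : nat -> R), (n <= m)%N ->
  al m * `|\sum_(j < n) a j *: z j| <= al n * `|\sum_(j < m) a j *: z j|.
have inv_hyp m : inv m -> hyp m z.
  move=> im a i ilm.
  have h2 n : (n <= m)%N -> `|\sum_(j < n) a j *: z j| <= 2 * `|\sum_(j < m) a j *: z j|.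
    move=> nm; apply: (@le_trans _ _ (al m * `|\sum_(j < n) a j *: z j|)).
      by rewrite ler_peMl.
    by rewrite (le_trans (im n a nm))// ler_wpM2r.
  have h3 : `|a i *: z i| <= 4 * `|\sum_(j < m) a j *: z j|.
    have -> : a i *: z i = \sum_(j < i.+1) a j *: z j - \sum_(j < i) a j *: z j.
      by rewrite big_ord_recr/= addrAC subrr add0r.
    rewrite (le_trans (ler_normB _ _))//.
    have := h2 _ ilm; have := h2 _ (ltnW ilm); lra.
  by apply: le_trans h3; rewrite normrZ ler_peMr.
have invP m : inv m.
  elim: m => [|m IH] n a; first by rewrite leqn0 => /eqP ->.
  rewrite leq_eqVlt => /predU1P[->//|]; rewrite ltnS => nm.
  have h1 := IH n a nm; have h2 := step m (inv_hyp m IH) a.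
  rewrite -(ler_pM2l (al0 m)) mulrCA.
  apply: (@le_trans _ _ (al m.+1 * (al n * `|\sum_(j < m) a j *: z j|))).
    by rewrite ler_wpM2l// ltW.
  by rewrite mulrCA (mulrCA (al m)) ler_wpM2l// ltW.
by move=> n a i; exact: inv_hyp.
Qed.

End NearlyOrthogonal.

(** * Finite-dimensional spans, Riesz's lemma, separated sequences *)

Lemma cauchy_seq_cvg (R : realType) (Y : completeNormedModType R) (u : nat -> Y) :
  (forall e, 0 < e -> exists N, forall n, (N <= n)%N -> `|u N - u n| < e) ->
  cvg (u @ \oo).
Proof.
move=> uc; apply: cauchy_cvg; apply: cauchy_exP => e /uc[N Nu].
by exists (u N), N => //= n /Nu; rewrite -ball_normE.
Qed.

Lemma small_invS (R : realType) (e : R) : 0 < e ->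
  exists N, forall n, (N <= n)%N -> n.+1%:R^-1 < e.
Proof.
move=> e0; exists (Num.bound e^-1) => n Nn.
rewrite invf_plt ?posrE//.
have /archi_boundP/lt_le_trans : 0 <= e^-1 by rewrite invr_ge0 ltW.
by apply; rewrite ler_nat ltnW.
Qed.

Section Span.
Variables (R : realType) (X : normedModType R).

Fixpoint in_span (s : seq X) (v : X) : Prop :=
  if s is y :: s' then exists c : R, in_span s' (v - c *: y) else v = 0.

Lemma in_span_lin s (a : R) u v :
  in_span s u -> in_span s v -> in_span s (a *: u + v).
Proof.
elim: s u v => [u v /= -> ->|y s IH u v /= [c cu] [d dv]].
  by rewrite scaler0 addr0.
exists (a * c + d); have := IH _ _ cu dv.
by rewrite scalerBr scalerA scalerDl opprD addrACA.
Qed.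

Lemma in_span0 s : in_span s 0.
Proof. by elim: s => //= y s IH; exists 0; rewrite scale0r subr0. Qed.

Lemma in_spanZ s (a : R) u : in_span s u -> in_span s (a *: u).
Proof. by move=> su; rewrite -[_ *: _]addr0; apply/in_span_lin/in_span0. Qed.

Lemma in_spanD s u v : in_span s u -> in_span s v -> in_span s (u + v).
Proof. by move=> su sv; rewrite -[u]scale1r; apply: in_span_lin. Qed.

Lemma mem_in_span s y : y \in s -> in_span s y.
Proof.
elim: s => //= x s IH; rewrite inE => /predU1P[->|/IH ys].
  by exists 1; rewrite scale1r subrr; exact: in_span0.
by exists 0; rewrite scale0r subr0.
Qed.

Lemma in_span_sum s v : in_span s v ->
  exists c : nat -> R, v = \sum_(i < size s) c i *: nth 0 s i.
Proof.
elim: s v => [v /= ->|y s IH v /= [c /IH[b vE]]].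
  by exists (fun=> 0); rewrite big_ord0.
exists (fun i => if i is j.+1 then b j else c).
by rewrite big_ord_recl/= -vE addrC subrK.
Qed.

(** Induction on the generators. If [y] is outside the span of [s], it lies at positive distance
    from it, which controls the coefficients of [y]: those in the approximants of [v] form a Cauchy
    sequence, and its limit is the coefficient sought. *)
Lemma in_span_closed s v :
  (forall e, 0 < e -> exists2 u, in_span s u & `|v - u| < e) -> in_span s v.
Proof.
elim: s v => [v vs|y s IH v vs] /=.
  apply/eqP; rewrite -normr_le0; apply/ler_addgt0Pl => e /vs[u -> ].
  by rewrite subr0 addr0 => /ltW.
have [sy|nsy] := pselect (in_span s y).
  exists 0; rewrite scale0r subr0; apply: IH => e /vs[u [c sc] ve].
  exists u => //; rewrite -(subrK (c *: y) u).
  by apply: in_spanD => //; exact: in_spanZ.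
have [d d0 dy] : exists2 d, 0 < d & forall u, in_span s u -> d <= `|y - u|.
  apply: contrapT => h; apply/nsy/IH => e e0; apply: contrapT => h'.
  apply: h; exists e => // u su; rewrite leNgt; apply/negP => yu.
  by apply: h'; exists u.
have dist (c : R) u : in_span s u -> d * `|c| <= `|c *: y - u|.
  move=> su; have [->|c0] := eqVneq c 0; first by rewrite normr0 mulr0.
  have -> : c *: y - u = c *: (y - c^-1 *: u).
    by rewrite scalerBr scalerA mulfV// scale1r.
  by rewrite normrZ mulrC ler_wpM2l// dy//; exact: in_spanZ.
have /choice[cu cuP] n : exists cu : R * X, in_span s cu.2 /\
    `|v - (cu.1 *: y + cu.2)| < n.+1%:R^-1.
  have [|u [c cu] vu] := vs n.+1%:R^-1; first by rewrite invr_gt0.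
  by exists (c, u - c *: y); split => //=; rewrite (addrC (c *: y)) subrK.
pose c n := (cu n).1.
have cc n m : d * `|c n - c m| < n.+1%:R^-1 + m.+1%:R^-1.
  have [sn vn] := cuP n; have [sm vm] := cuP m.
  have su : in_span s ((cu m).2 - (cu n).2).
    by rewrite addrC -scaleN1r; apply: in_span_lin.
  apply: (le_lt_trans (dist _ _ su)).
  have -> : (c n - c m) *: y - ((cu m).2 - (cu n).2) =
      (v - ((cu m).1 *: y + (cu m).2)) - (v - ((cu n).1 *: y + (cu n).2)).
    by rewrite [in RHS]opprB [RHS]addrC addrA subrK scalerBl opprB addrACA -opprD.
  by rewrite (le_lt_trans (ler_normB _ _))// addrC ltrD.
have /cvg_ex[/= l cl] : cvg (c @ \oo).
  apply: cauchy_seq_cvg => e e0.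
  have [N NP] := small_invS (divr_gt0 (mulr_gt0 e0 d0) (ltr0n R 2)).
  exists N => n Nn; rewrite -(ltr_pM2l d0) (lt_trans (cc _ _))//.
  rewrite (mulrC d) [ltRHS]splitr ltrD//; first exact: NP.
  exact: NP.
exists l; apply: IH => e e0.
have y1 : 0 < `|y| + 1 by rewrite ltr_wpDl.
have e2 : 0 < e / 2 by rewrite divr_gt0.
have [N NP] := small_invS e2.
move/cvgrPdist_lt : cl => /(_ _ (divr_gt0 e2 y1))[M _ MP].
pose n := maxn N M; have [sn vn] := cuP n.
exists (cu n).2 => //.
have -> : v - l *: y - (cu n).2 =
    (v - ((cu n).1 *: y + (cu n).2)) - (l - c n) *: y.
  rewrite /c scalerBl opprB addrA (addrAC v (- (_ + _))) opprD.
  by rewrite [in RHS]addrA addrK addrAC.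
rewrite (le_lt_trans (ler_normB _ _))// [ltRHS]splitr ltrD//.
  by rewrite (lt_trans vn)// NP// leq_maxl.
have := MP n; rewrite /= leq_maxr => /(_ isT); rewrite ltr_pdivlMr//.
by apply: le_lt_trans; rewrite normrZ ler_wpM2l// lerDl.
Qed.

Hypothesis X_inf : infinite_dimensional X.

(** Take [v - u] divided by the distance [i] from [v] to the span, with [u] optimal up to a factor
    2; [i] is positive because the span is closed. *)
Lemma riesz_lemma s : exists x : X, `|x| <= 2 /\
  forall y, in_span s y -> 1 <= `|x - y|.
Proof.
have [v vs] := X_inf s.
have nsv : ~ in_span s v by move=> /in_span_sum[c]; exact: (vs (fun i => c i)).
have [d d0 dv] : exists2 d, 0 < d & forall u, in_span s u -> d <= `|v - u|.
  apply: contrapT => h; apply/nsv/in_span_closed => e e0; apply: contrapT => h'.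
  apply: h; exists e => // u su; rewrite leNgt; apply/negP => yu.
  by apply: h'; exists u.
pose D := [set `|v - u| | u in in_span s]; pose i := inf D.
have D0 : D !=set0 by exists `|v - 0|, 0 => //; exact: in_span0.
have Dlb : has_lbound D by exists d => _ [u su <-]; exact: dv.
have i0 : 0 < i.
  by apply: (lt_le_trans d0); apply: lb_le_inf => // _ [u su <-]; exact: dv.
have [_ [u su <-] ui] := inf_adherent i0 (conj D0 Dlb).
exists (i^-1 *: (v - u)); split.
  rewrite normrZ gtr0_norm ?invr_gt0// ler_pdivrMl// ltW//.
  by rewrite (lt_le_trans ui)// mulrDr mulr1.
move=> y sy; rewrite -(@ler_pM2l _ i)// mulr1.
have -> : i * `|i^-1 *: (v - u) - y| = `|v - (u + i *: y)|.
  rewrite -{1}(gtr0_norm i0) -normrZ scalerBr scalerA mulfV ?gt_eqF//.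
  by rewrite scale1r opprD addrA.
apply: ge_inf => //; exists (u + i *: y) => //.
by apply: in_spanD => //; exact: in_spanZ.
Qed.

Lemma separated_sequence : exists x : nat -> X,
  (forall k, `|x k| <= 2) /\ forall k l, k <> l -> 1 <= `|x k - x l|.
Proof.
have /choice[f fP] := riesz_lemma.
pose xs := fix xs m := if m is m'.+1 then rcons (xs m') (f (xs m')) else [::].
pose x m := f (xs m).
have xsE m : xs m = mkseq x m by elim: m => //= m IH; rewrite mkseqS -IH.
exists x; split => [k|k l kl]; first by have [] := fP (xs k).
wlog lk : k l kl / (l < k)%N.
  move=> H; move/eqP : (kl); rewrite neq_ltn => /orP[kl'|kl'].
    by rewrite distrC; apply: H => //; exact: nesym.
  exact: H.
have [_] := fP (xs k); apply; apply: mem_in_span.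
by rewrite xsE; apply/mapP; exists l => //; rewrite mem_iota.
Qed.

End Span.

(** * A copy of [c0] from a sequence with two-sided estimates *)

Section C0Sequence.
Variables (R : realType) (X : completeNormedModType R).
Variables (A B : R) (y : nat -> X).
Hypotheses (A_gt0 : 0 < A) (B_ge0 : 0 <= B) (y_coord : coord_bounded A y).
Hypothesis y_upper : forall n (a : nat -> R) r, (forall i, `|a i| <= r) ->
  `|\sum_(i < n) a i *: y i| <= B * r.

Let S (u : nat -> R) n := \sum_(i < n) u i *: y i.

Let cvgS (u : nat -> R) : c0 u -> cvg (S u @ \oo).
Proof.
move=> u0; apply: cauchy_seq_cvg => e e0.
have B1 : 0 < B + 1 by rewrite ltr_wpDl.
move/cvgrPdist_lt : u0 => /(_ _ (divr_gt0 e0 B1))[N _ NP]; exists N => n Nn.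
pose v i := if (i < N)%N then 0 else u i.
have -> : S u N - S u n = - \sum_(i < n) v i *: y i.
  rewrite /S (big_ord_widen n (fun i => u i *: y i))// big_mkcond -sumrB -sumrN.
  apply: eq_bigr => i _; rewrite /v; case: ifP => _.
    by rewrite subrr scale0r oppr0.
  by rewrite sub0r.
rewrite normrN; apply: (@le_lt_trans _ _ (B * (e / (B + 1)))).
  apply: y_upper => i; rewrite /v; case: ltnP => [_|/NP /=].
    by rewrite normr0 divr_ge0// ltW.
  by rewrite sub0r normrN => /ltW.
by rewrite mulrA ltr_pdivrMr// mulrDr mulr1 mulrC ltrDl.
Qed.

Let near_lim (u : nat -> R) N (e : R) : c0 u -> 0 < e ->
  exists2 n, (N <= n)%N & `|lim (S u @ \oo) - S u n| < e.
Proof.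
move=> /cvgS/cvgrPdist_lt/[apply] -[M _ MP]; exists (maxn N M).
  exact: leq_maxl.
by apply: MP => /=; exact: leq_maxr.
Qed.

(** The embedding sends [u] to the sum of the series of the [u i *: y i]; outside [c0] its value is
    whatever [lim] returns. *)
Lemma contains_c0_of_seq : contains_c0 X.
Proof.
have coord (u : nat -> R) i : c0 u -> `|u i| <= A * `|lim (S u @ \oo)|.
  move=> u0; apply/ler_addgt0Pr => e e0.
  have [n ilen un] := near_lim i.+1 u0 (divr_gt0 e0 A_gt0).
  apply: (le_trans (y_coord u ilen)); rewrite -/(S u n).
  rewrite ltr_pdivlMr// mulrC in un.
  apply: (@le_trans _ _ (A * (`|lim (S u @ \oo)| + `|lim (S u @ \oo) - S u n|))).
    rewrite ler_wpM2l ?(ltW A_gt0)//.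
    by rewrite -{1}[S u n](subKr (lim (S u @ \oo))) ler_normB.
  by rewrite mulrDr lerD2l ltW.
have hassup (u : nat -> R) : c0 u -> has_sup [set `|u n| | n in [set: nat]].
  move=> u0; split; first by exists `|u 0%N|, 0%N.
  by exists (A * `|lim (S u @ \oo)|) => _ [n _ <-]; exact: coord.
exists (fun u : nat -> R => lim (S u @ \oo)); split.
  move=> a u v u0 v0; apply: cvg_lim => //.
  have -> : S (fun n => a * u n + v n) = (fun n => a *: S u n + S v n).
    apply/funext => n; rewrite /S scaler_sumr -big_split/=.
    by apply: eq_bigr => i _; rewrite scalerDl scalerA.
  by apply: cvgD; [apply: cvgZr; exact: cvgS|exact: cvgS].
exists A^-1, B; split; first by rewrite invr_gt0.
move=> u u0; split.
  rewrite ler_pdivrMl//; apply: ge_sup; first by have [] := hassup u u0.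
  by move=> _ [n _ <-]; exact: coord.
apply/ler_addgt0Pr => e e0; have [n _ un] := near_lim 0 u0 e0.
have ub i : `|u i| <= c0_norm u.
  by apply: ub_le_sup; [have [] := hassup u u0 | exists i].
rewrite -[X in `|X|](subrK (S u n)) addrC (le_trans (ler_normD _ _))//.
by rewrite lerD ?(ltW un)// y_upper.
Qed.

End C0Sequence.

(** * Sums over scattered indices, and small perturbations *)

Section Chains.
Variables (R : realType) (X : normedModType R).

(** Estimates for sequences concern initial segments, whereas the chains of a tree occupy scattered
    codes. Zero coefficients fill the gaps. *)
Lemma sum_reindex (f : nat -> nat) (l : nat) (a : nat -> R) (r : R) :
    {in [pred i | (i < l)%N] &, injective f} -> (forall i, `|a i| <= r) ->
  exists N (b : nat -> R), (forall j, `|b j| <= r) /\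
    (forall i, (i < l)%N -> (f i < N)%N /\ b (f i) = a i) /\
    forall z : nat -> X, \sum_(i < l) a i *: z (f i) = \sum_(j < N) b j *: z j.
Proof.
move=> finj ar; pose b j := \sum_(i < l | f i == j) a i.
have bf i : (i < l)%N -> b (f i) = a i.
  move=> il; rewrite /b (big_pred1 (Ordinal il))// => j /=.
  apply/eqP/eqP => [fij|->//]; apply/val_inj => /=.
  by apply: finj; rewrite ?inE.
pose N := (\max_(i < l) f i).+1.
have fN i : (i < l)%N -> (f i < N)%N.
  by move=> il; rewrite ltnS (leq_bigmax (Ordinal il)).
exists N, b; split; [|split] => [j|i il|z].
- have [[i il <-]|h] := pselect (exists2 i, (i < l)%N & f i = j).
    by rewrite bf.
  rewrite /b big_pred0 ?normr0 ?(le_trans _ (ar 0%N))// => i.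
  by apply/eqP => fij; apply: h; exists i.
- by split; [exact: fN|exact: bf].
- under [RHS]eq_bigr do rewrite scaler_suml big_mkcond.
  rewrite exchange_big/=; apply: eq_bigr => i _.
  rewrite -big_mkcond (big_pred1 (Ordinal (fN i (ltn_ord i))))//.
Qed.

Lemma coord_bounded_reindex (z : nat -> X) (C : R) (f : nat -> nat) (l : nat)
    (a : nat -> R) i : coord_bounded C z ->
    {in [pred i | (i < l)%N] &, injective f} -> (i < l)%N ->
  `|a i| <= C * `|\sum_(j < l) a j *: z (f j)|.
Proof.
move=> zC finj il; pose a' j := if (j < l)%N then a j else 0.
have [r ar] : exists r, forall j, `|a' j| <= r.
  exists (\sum_(k < l) `|a k|) => j; rewrite /a'; case: ltnP => jl.
    by rewrite (bigD1 (Ordinal jl))//= lerDl sumr_ge0.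
  by rewrite normr0 sumr_ge0.
have [N [b [_ [bf bz]]]] := sum_reindex finj ar.
have -> : \sum_(j < l) a j *: z (f j) = \sum_(j < l) a' j *: z (f j).
  by apply: eq_bigr => j _; rewrite /a' ltn_ord.
rewrite bz; have [fN bE] := bf i il.
by have := zC N b _ fN; rewrite bE /a' il.
Qed.

Lemma sum_half (l : nat) : \sum_(i < l) (2^-1 : R) ^+ i.+2 <= 2^-1.
Proof.
suff -> : \sum_(i < l) (2^-1 : R) ^+ i.+2 = 2^-1 - 2^-1 ^+ l.+1.
  by rewrite lerBlDr lerDl exprn_ge0// invr_ge0.
elim: l => [|l IH]; first by rewrite big_ord0 expr1 subrr.
by rewrite big_ord_recr/= IH !exprS; field.
Qed.

(** The tolerances sum to at most 1/2, so a sum changes by at most half of any bound on its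
    coefficients. For the lower estimate that bound is the norm of the original sum itself. *)
Lemma perturbation (l : nat) (y y' : nat -> X) (K : R) :
    (forall i, `|y i - y' i| <= 2^-1 ^+ i.+2) ->
    (forall (a : nat -> R) i, (i < l)%N ->
      `|a i| <= `|\sum_(j < l) a j *: y j|) ->
    (forall (a : nat -> R) r, (forall i, `|a i| <= r) ->
      `|\sum_(j < l) a j *: y j| <= K * r) ->
  (forall (a : nat -> R) i, (i < l)%N ->
    `|a i| <= 2 * `|\sum_(j < l) a j *: y' j|) /\
  (forall (a : nat -> R) r, (forall i, `|a i| <= r) ->
    `|\sum_(j < l) a j *: y' j| <= (K + 1) * r).
Proof.
move=> yy' lo up.
have diff (a : nat -> R) r : 0 <= r -> (forall i, (i < l)%N -> `|a i| <= r) ->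
    `|\sum_(j < l) a j *: y j - \sum_(j < l) a j *: y' j| <= r / 2.
  move=> r0 ar; rewrite -sumrB (le_trans (ler_norm_sum _ _ _))//.
  apply: (@le_trans _ _ (r * \sum_(j < l) 2^-1 ^+ j.+2)); last first.
    by rewrite ler_wpM2l// sum_half.
  rewrite mulr_sumr ler_sum// => j _; rewrite -scalerBr normrZ.
  by rewrite ler_pM// ar.
split=> [a i il|a r ar].
  have := diff a _ (normr_ge0 _) (lo a).
  set s := \sum_(j < l) _; set s' := \sum_(j < l) _ => h.
  have h1 : `|s| <= `|s'| + `|s - s'| by rewrite -{1}[s](subrK s') addrC ler_normD.
  have := lo a i il; rewrite -/s; lra.
have r0 : 0 <= r by rewrite (le_trans _ (ar 0%N)).
have := diff a r r0 (fun i _ => ar i); have := up a r ar.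
set s := \sum_(j < l) _; set s' := \sum_(j < l) _ => h h'.
have h1 : `|s'| <= `|s| + `|s - s'| by rewrite -{1}[s'](subKr s) ler_normB.
by rewrite mulrDl mul1r; lra.
Qed.

End Chains.

(** * Codes along a chain, infinite branches, dense sequences *)

Lemma take_pickle_inj (u : seq nat) (k : nat -> nat) :
  {in [pred i | (i < (size u).+1)%N] &,
    injective (fun i => pickle (take i u, k i))}.
Proof.
move=> i j; rewrite !inE !ltnS => iu ju /(pcan_inj pickleK)[/(congr1 size)].
by rewrite !size_takel.
Qed.

(** Descents start only at nodes in [T], so an inaccessible node lies in [T] and has an inaccessible
    child; such children are followed forever. *)
Lemma infinite_branch (T : seq nat -> Prop) :
    ~ Acc (fun s' s => T s /\ exists n, s' = rcons s n) [::] ->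
  exists g : nat -> nat, forall n, T (mkseq g n).
Proof.
set Rel := (X in ~ Acc X _) => nA.
have next s : exists n, ~ Acc Rel s -> T s /\ ~ Acc Rel (rcons s n).
  have [As|nAs] := pselect (Acc Rel s); first by exists 0%N.
  apply: contrapT => h; apply: nAs; split => _ [Ts [n ->]].
  by apply: contrapT => nAn; apply: h; exists n.
have [f fP] := choice next.
pose us := fix us n := if n is m.+1 then rcons (us m) (f (us m)) else [::].
have usE n : us n = mkseq (f \o us) n.
  by elim: n => //= n IH; rewrite mkseqS -IH.
have usA n : ~ Acc Rel (us n) by elim: n => //= n /fP[].
by exists (f \o us) => n; rewrite -usE; have [] := fP _ (usA n).
Qed.

Lemma separable_dense_seq (R : realType) (X : normedModType R) : separable X ->
  exists d : nat -> X, forall x e, 0 < e -> exists n, `|x - d n| < e.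
Proof.
move=> [D [/countable_injP[f finj] Dd]].
have /choice[d dP] n : exists x, forall y, D y -> f y = n -> y = x.
  have [[x [Dx fx]]|h] := pselect (exists x, D x /\ f x = n).
    by exists x => y Dy fy; apply: finj; rewrite ?inE// fx fy.
  by exists 0 => y Dy fy; exfalso; apply: h; exists y.
exists d => x e e0.
have [|y [+ Dy]] := Dd (ball x e) _ (ball_open x e).
  by exists x; exact: ballxx.
by rewrite -ball_normE /= => xy; exists (f y); rewrite -(dP (f y) y Dy).
Qed.

(** * Families of vectors over a well-founded tree *)

Section Trees.
Variables (R : realType) (X : completeNormedModType R) (K : R).
Hypotheses (X_inf : infinite_dimensional X) (K_ge0 : 0 <= K).
Hypothesis elX : K_elastic K X.
Variable T : seq nat -> Prop.

(* The vectors attached to the node u are the z (pickle (u, k)), k : nat; having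
   infinitely many of them allows passing to differences at every node. *)
Definition chains_upper (s : seq nat) (z : nat -> X) :=
  forall (u : seq nat) (k : nat -> nat) (a : nat -> R) r,
    (forall i, T (s ++ take i u)) -> (forall i, `|a i| <= r) ->
    `|\sum_(i < (size u).+1) a i *: z (pickle (take i u, k i))| <= K * r.

(** The bound on [z j] also covers indices on no chain inside [T], where [chains_upper] is
    silent. *)
Definition c0_tree (s : seq nat) (z : nat -> X) :=
  [/\ coord_bounded 1 z, (forall j, `|z j| <= K) & chains_upper s z].

(** Root vectors come from a separated sequence, the others from the families of the children.
    Differences achieve joint coordinate bounds, and [elastic_improve] then restores the constants 1
    and [K], so that nothing is lost along the induction. *)
Lemma c0_tree_step (s : seq nat) :
  (T s -> forall n, exists z, c0_tree (rcons s n) z) -> exists z, c0_tree s z.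
Proof.
move=> IH; have [w0 [w0B w0sep]] := separated_sequence X_inf.
(* When [T s] fails no chain estimate is due, and [w0] serves for every child. *)
have /choice[w wP] n : exists w : nat -> X, [/\ forall j, `|w j| <= K + 2,
    (forall k l, k <> l -> 1 <= `|w k - w l|) &
    (T s -> chains_upper (rcons s n) w)].
  have [Ts|nTs] := pselect (T s); last first.
    by exists w0; split => // j; rewrite (le_trans (w0B j))// lerDr.
  have [z [zc zK zu]] := IH Ts n; exists z; split => // [j|k l kl].
    by rewrite (le_trans (zK j))// lerDl.
  pose f i := if i == 0%N then k else l.
  have finj : {in [pred i | (i < 2)%N] &, injective f}.
    by move=> [|[|//]] [|[|//]] //= _ _ /esym // ; exact: nesym.
  have := coord_bounded_reindex (fun i => if i == 0%N then 1 else -1)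
    zc finj (ltn0Sn 1).
  by rewrite !big_ord_recl big_ord0/= normr1 mul1r scale1r addr0 scaleN1r.
(* The row of a node [n :: u] lists the vectors that the family of child [n] attaches to [u]; all
   other rows are [w0]. *)
pose P j := match unpickle j : option (seq nat * nat) with
  | Some (n :: u, _) => fun k => w n (pickle (u, k))
  | _ => w0 end.
have PB j k : `|P j k| <= K + 2.
  rewrite /P; case: unpickle => [[[|n u] m]|].
  - by rewrite (le_trans (w0B k))// lerDr.
  - by have [+ _ _] := wP n; apply.
  - by rewrite (le_trans (w0B k))// lerDr.
have Psep j k l : k <> l -> 1 <= `|P j k - P j l|.
  rewrite /P; case: unpickle => [[[|n u] m]|] kl; try exact: w0sep.
  have [_ + _] := wP n; apply => /(pcan_inj pickleK)[].
  exact: kl.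
have [p [q zc]] := select_differences PB Psep.
set z := fun i => _ in zc.
have zB j : `|z j| <= 2 * (K + 2).
  by rewrite (le_trans (ler_normB _ _))// mulr_natl mulr2n lerD.
(* The root term contributes [2 * (K + 2)]; the rest of a chain is a difference of two chain sums
   for one child and contributes [2 * K]. *)
have M0 : 0 < 4 * K + 4 by rewrite ltr_wpDl// mulr_ge0.
have [x [xc xu]] := elastic_improve K_ge0 elX (ltr0n R 4) M0 zc.
have xf f l (a : nat -> R) r : {in [pred i | (i < l)%N] &, injective f} ->
    (forall i, `|a i| <= r) ->
    `|\sum_(i < l) a i *: z (f i)| <= (4 * K + 4) * r ->
    `|\sum_(i < l) a i *: x (f i)| <= K * r.
  move=> finj ar; have [N [b [br [_ bE]]]] := sum_reindex X finj ar.
  by rewrite !bE; exact: xu.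
exists x; split => // [j|u k a r Tu ar].
  have := @xf (fun=> j) 1%N (fun=> 1) 1.
  rewrite !big_ord1 !scale1r !mulr1; apply.
  - by move=> [|//] [|//].
  - by move=> _; rewrite normr1.
  - by rewrite (le_trans (zB j))//; move: K_ge0; lra.
have r0 : 0 <= r by rewrite (le_trans _ (ar 0%N)).
apply: (xf (fun i => pickle (take i u, k i))) => //; first exact: take_pickle_inj.
have az j : `|a 0%N *: z j| <= 2 * (K + 2) * r.
  by rewrite normrZ mulrC ler_pM.
rewrite big_ord_recl/= (le_trans (ler_normD _ _))//.
have -> : (4 * K + 4) * r = 2 * (K + 2) * r + 2 * (K * r) by ring.
apply: lerD; first exact: az.
case: u Tu => [|n u] Tu; first by rewrite big_ord0 normr0 !mulr_ge0.
have Ts : T s by have := Tu 0%N; rewrite take0 cats0.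
have [_ _ /(_ Ts) wn] := wP n.
(* The differences along the chain amount to two choices of columns, by [p] and by [q], and the free
   [k] of [chains_upper] admits both. The shift by one removes the root. *)
pose c (h : nat -> nat) i := h (pickle (take i.+1 (n :: u), k i.+1)).
have -> : \sum_(i < (size u).+1) a (bump 0 i) *:
    z (pickle (take (bump 0 i) (n :: u), k (bump 0 i))) =
  \sum_(i < (size u).+1) a i.+1 *: w n (pickle (take i u, c p i)) -
  \sum_(i < (size u).+1) a i.+1 *: w n (pickle (take i u, c q i)).
  rewrite -sumrB; apply: eq_bigr => i _; rewrite -scalerBr.
  by rewrite /c /z /P /bump leq0n add1n pickleK /=.
rewrite (le_trans (ler_normB _ _))// mulr_natl mulr2n.
have Tnu i : T (rcons s n ++ take i u) by rewrite cat_rcons; exact: (Tu i.+1).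
by apply: lerD; [apply: (wn u (c p) (a \o succn))|apply: (wn u (c q) (a \o succn))] => // i; exact: ar.
Qed.

Lemma c0_tree_exists (s : seq nat) :
  Acc (fun s' s => T s /\ exists n, s' = rcons s n) s -> exists z, c0_tree s z.
Proof.
by elim=> {}s _ IH; apply: c0_tree_step => Ts n; apply: IH; split => //; exists n.
Qed.

End Trees.

(** * The tree of index sequences that approximate bases of [l_infty^l] *)

Section Branches.
Variables (R : realType) (X : completeNormedModType R) (K : R).
Variable d : nat -> X.
Hypothesis d_dense : forall x e, 0 < e -> exists n, `|x - d n| < e.

(** The constants [2] and [K + 1] are what [perturbation] makes of the [1] and [K] of [c0_tree], so
    approximating a chain by [d] leads back into the tree. *)
Definition c0_node (u : seq nat) :=
  (forall (a : nat -> R) i, (i < size u)%N ->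
    `|a i| <= 2 * `|\sum_(j < size u) a j *: d (nth 0%N u j)|) /\
  (forall (a : nat -> R) r, (forall i, `|a i| <= r) ->
    `|\sum_(j < size u) a j *: d (nth 0%N u j)| <= (K + 1) * r).

Lemma c0_node_mkseq (g : nat -> nat) n : c0_node (mkseq g n) <->
  (forall (a : nat -> R) i, (i < n)%N ->
    `|a i| <= 2 * `|\sum_(j < n) a j *: d (g j)|) /\
  (forall (a : nat -> R) r, (forall i, `|a i| <= r) ->
    `|\sum_(j < n) a j *: d (g j)| <= (K + 1) * r).
Proof.
rewrite /c0_node size_mkseq.
have E (a : nat -> R) : \sum_(j < n) a j *: d (nth 0%N (mkseq g n) j) =
    \sum_(j < n) a j *: d (g j).
  by apply: eq_bigr => j _; rewrite nth_mkseq.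
by split=> -[h1 h2]; split => a; move: (h1 a) (h2 a); rewrite E.
Qed.

(** The vector [d (g n)] approximates the one attached to the node [us n]. The [n.+1] vectors
    attached to [us 0], ..., [us n] form a chain, so their approximations make [us n.+1] a node
    too. *)
Lemma branch_of_c0_tree (z : nat -> X) : 0 <= K -> c0_tree K c0_node [::] z ->
  exists g : nat -> nat, forall n, c0_node (mkseq g n).
Proof.
move=> K0 [zc _ zu].
have /choice[ap apP] (t : X * nat) : exists n, `|t.1 - d n| <= 2^-1 ^+ t.2.+2.
  by have [|n /ltW] := d_dense t.1 (_ : 0 < 2^-1 ^+ t.2.+2);
    [rewrite exprn_gt0// invr_gt0 | exists n].
pose us := fix us n :=
  if n is m.+1 then rcons (us m) (ap (z (pickle (us m, 0%N)), m)) else [::].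
pose y n := z (pickle (us n, 0%N)); pose g n := ap (y n, n).
have usE n : us n = mkseq g n by elim: n => //= n IH; rewrite mkseqS -IH.
(* Strong induction, since the chain estimate asks every prefix of [us n] to be a node. *)
exists g => n; have [m] := ubnP n; elim: m n => // m IH [_|n].
  apply/c0_node_mkseq; split => // a r ar.
  by rewrite big_ord0 normr0 mulr_ge0 ?addr_ge0// (le_trans _ (ar 0%N)).
rewrite ltnS => nm; apply/c0_node_mkseq.
have szu : size (us n) = n by rewrite usE size_mkseq.
have takeu i : (i <= n)%N -> take i (us n) = us i.
  move=> i_n; rewrite !usE /mkseq -map_take take_iota.
  by rewrite (minn_idPl i_n).
have sumE (a : nat -> R) : \sum_(j < n.+1) a j *: y j =
    \sum_(j < n.+1) a j *: z (pickle (take j (us n), 0%N)).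
  by apply: eq_bigr => j _; rewrite takeu// -ltnS.
apply: (@perturbation _ _ n.+1 y (fun j => d (g j)) K) => [i|a i il|a r ar].
- exact: (apP (y i, i)).
- rewrite sumE -[leRHS]mul1r.
  apply: (coord_bounded_reindex (f := fun j => pickle (take j (us n), 0%N)) _ zc _ il).
  by rewrite -{1}szu; exact: (@take_pickle_inj _ (fun=> 0%N)).
- rewrite sumE; have := zu (us n) (fun=> 0%N) a r; rewrite szu; apply => // i.
  rewrite cat0s; have [i_n|/ltnW n_i] := leqP i n.
    by rewrite takeu// usE; apply: IH; rewrite (leq_ltn_trans i_n).
  by rewrite take_oversize ?szu// usE; exact: IH.
Qed.

Lemma contains_c0_of_branch (g : nat -> nat) : 0 <= K ->
  (forall n, c0_node (mkseq g n)) -> contains_c0 X.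
Proof.
move=> K0 /(_ _)/c0_node_mkseq gP.
apply: (@contains_c0_of_seq _ _ 2 (K + 1) (d \o g)) => //.
- exact: addr_ge0.
- by move=> n a i; have [+ _] := gP n; apply.
- by move=> n a r; have [_ +] := gP n; apply.
Qed.

End Branches.

(** * The dichotomy between well-founded and ill-founded trees *)

Theorem theorem2p6 (R : realType) (X : completeNormedModType R) :
  separable X -> infinite_dimensional X -> elastic X -> contains_c0 X.
Proof.
move=> /separable_dense_seq[d d_dense] X_inf [K0 el0].
have [K K_ge0 elX] : exists2 K, 0 <= K & K_elastic K X.
  exists `|K0| => // Y /el0[T [Tlin TK]]; exists T; split => // y.
  have [-> /le_trans h] := TK y; split => //; apply: h.
  by rewrite ler_wpM2r// ler_norm.
suff [g gP] : exists g : nat -> nat, forall n, c0_node K d (mkseq g n).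
  exact: contains_c0_of_branch gP.
apply: contrapT => nobranch.
(* Both alternatives yield a branch: an inaccessible root directly, an accessible one through the
   family built by induction. *)
have [wf|/infinite_branch//] :=
    pselect (Acc (fun s' s => c0_node K d s /\ exists n, s' = rcons s n) [::]).
have [z zP] := c0_tree_exists X_inf K_ge0 elX wf.
exact: nobranch (branch_of_c0_tree d_dense K_ge0 zP).
Qed.
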